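(* For $n\ge 1$ let $E_n$ be the following condition in the $2n+2$ variables $a_0,b_0,\dots,a_n,b_n$: $$a_0\perp b_0\ \&\ a_1\perp b_1\ \&\ \cdots\ \&\ a_n\perp b_n\ \Rightarrow\ (a_0\cup b_0)\cap(a_1\cup b_1)\cap\cdots\cap(a_n\cup b_n)\le b_0\cup\bigl(a_0\cap(a_1\cup R_n)\bigr),$$ where the terms $R_n$ are constructed recursively as follows. Write $s_{ij}$ for the expression $(a_i\cup a_j)\cap(b_i\cup b_j)$. Then $R_1$ is $s_{01}$, and for $n\ge2$ the term $R_n$ is obtained from $R_{n-1}$ by replacing every subexpression of the form $s_{ij}$ ($i,j<n$) by $s_{ij}\cap(s_{in}\cup s_{jn})$. (Thus $E_1$ is the 3OA law in its 4-variable form.) Then: (i) $E_2$ is the 4OA law in its 6-variable form, i.e. the condition $$a_0 \perp b_0 \ \&\ a_1 \perp b_1 \ \&\ a_2\perp b_2 \ \Rightarrow\ (a_0\cup b_0)\cap(a_1\cup b_1)\cap(a_2\cup b_2)\le b_0\cup\Bigl(a_0\cap\bigl(a_1\cup\bigl(s_{01}\cap(s_{02}\cup s_{12})\bigr)\bigr)\Bigr).$$ (ii) For every $n\ge 3$: $E_n$ implies the 4OA law (every orthomodular lattice satisfying $E_n$ is a 4OA); $E_n$ holds in the lattice $\mathcal C(\mathcal H)$ of closed subspaces of every Hilbert space $\mathcal H$; and $E_n$ cannot be inferred from the 4OA law, i.e. there is a 4OA in which $E_n$ fails.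
   Context: Lattice notation: $\cap$ is meet, $\cup$ is join, $'$ is orthocomplementation, and $a\perp b$ means $a\le b'$. An ortholattice (OL) is a bounded lattice with an order-reversing involutive complementation $'$; an orthomodular lattice (OML) is an ortholattice in which $a\le b$ implies $b=a\cup(a'\cap b)$. A condition holds in a lattice if it holds for all values of its variables there. Put $a\to_1 b:=a'\cup(a\cap b)$, $\ a\overset{c}{\equiv}b:=((a\to_1 c)\cap(b\to_1 c))\cup((a'\to_1 c)\cap(b'\to_1 c))$, and $a\overset{c,d}{\equiv}b:=(a\overset{d}{\equiv}b)\cup((a\overset{d}{\equiv}c)\cap(b\overset{d}{\equiv}c))$. A 4OA is an ortholattice satisfying the 4OA law $(a\to_1 d)\cap(a\overset{c,d}{\equiv}b)\le b\to_1 d$ for all $a,b,c,d$ (every 4OA is an OML). A Hilbert space $\mathcal H$ over a field $\mathcal K$ is understood in the lattice-theoretic sense: a vector space over a (possibly skew) field $\mathcal K$ with involution, with an anisotropic Hermitian form such that $X+X^\perp=\mathcal H$ whenever $X=X^{\perp\perp}$; this includes ordinary real, complex and quaternionic Hilbert spaces. $\mathcal C(\mathcal H)=\{X\subseteq\mathcal H: X \text{ a subspace},\ X^{\perp\perp}=X\}$, ordered by inclusion, with meet $X\cap Y$ (intersection), join $(X+Y)^{\perp\perp}$ and orthocomplement $X^\perp$. *)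

(* Defs.v *)
From HB Require Import structures.
From mathcomp Require Import all_boot all_order all_algebra.
From mathcomp Require Import boolp classical_sets.

Set Implicit Arguments.
Unset Strict Implicit.
Unset Printing Implicit Defensive.

Import Order.TTheory GRing.Theory.

Local Open Scope order_scope.

Reserved Notation "a ^!" (format "a ^!").

HB.mixin Record TBLattice_isOrtholattice d T of Order.TBLattice d T := {
  ocompl : T -> T;
  ocomplK : involutive ocompl;
  ocompl_antitone : forall a b : T, a <= b -> ocompl b <= ocompl a;
  meet_ocompl : forall a : T, a `&` ocompl a = \bot;
  join_ocompl : forall a : T, a `|` ocompl a = \top;
}.

#[short(type="ortholatticeType")]
HB.structure Definition Ortholattice d :=
  { T of TBLattice_isOrtholattice d T & Order.TBLattice d T }.

Notation "a ^!" := (ocompl a) : order_scope.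

Section OrtholatticeNotions.
Context {d : Order.disp_t} {L : ortholatticeType d}.
Implicit Types a b c : L.

Definition operp a b : bool := a <= b^!.

Definition oimp1 a b : L := a^! `|` (a `&` b).

(* [oequiv c a b] is $a \overset{c}{\equiv} b$ and [oequiv2 c e a b] is
   $a \overset{c,e}{\equiv} b$. *)
Definition oequiv c a b : L :=
  (oimp1 a c `&` oimp1 b c) `|` (oimp1 a^! c `&` oimp1 b^! c).

Definition oequiv2 c e a b : L :=
  oequiv e a b `|` (oequiv e a c `&` oequiv e b c).

End OrtholatticeNotions.

Definition orthomodular d (L : ortholatticeType d) : Prop :=
  forall a b : L, a <= b -> b = a `|` (a^! `&` b).

Definition fourOA d (L : ortholatticeType d) : Prop :=
  forall a b c e : L, oimp1 a e `&` oequiv2 c e a b <= oimp1 b e.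

(* [R_n] is defined by a substitution on expressions, hence the syntax:
   [OAs i j] stands for (a_i `|` a_j) `&` (b_i `|` b_j). *)
Inductive oaTerm : Type :=
  | OAs of nat & nat
  | OAmeet of oaTerm & oaTerm
  | OAjoin of oaTerm & oaTerm.

Fixpoint oa_subst (n : nat) (t : oaTerm) : oaTerm :=
  match t with
  | OAs i j =>
      if (i < n)%N && (j < n)%N
      then OAmeet (OAs i j) (OAjoin (OAs i n) (OAs j n)) else OAs i j
  | OAmeet t1 t2 => OAmeet (oa_subst n t1) (oa_subst n t2)
  | OAjoin t1 t2 => OAjoin (oa_subst n t1) (oa_subst n t2)
  end.

(* [oaR 0] is a dummy value: the terms start at [R_1]. *)
Fixpoint oaR (n : nat) : oaTerm :=
  match n with
  | 0 | 1 => OAs 0 1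
  | m.+1 => oa_subst m.+1 (oaR m)
  end.

Fixpoint oa_eval d (L : ortholatticeType d) (a b : nat -> L) (t : oaTerm) : L :=
  match t with
  | OAs i j => (a i `|` a j) `&` (b i `|` b j)
  | OAmeet t1 t2 => oa_eval a b t1 `&` oa_eval a b t2
  | OAjoin t1 t2 => oa_eval a b t1 `|` oa_eval a b t2
  end.

(* Only the values of [a] and [b] at indices [i <= n] occur. *)
Definition oaE (n : nat) d (L : ortholatticeType d) : Prop :=
  forall a b : nat -> L,
    (forall i, (i <= n)%N -> operp (a i) (b i)) ->
    \meet_(i < n.+1) (a i `|` b i)
      <= b 0%N `|` (a 0%N `&` (a 1%N `|` oa_eval a b (oaR n))).

Local Open Scope ring_scope.
Local Open Scope classical_set_scope.

Definition form_orth (K : pzRingType) (V : Type) (f : V -> V -> K)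
    (X : set V) : set V :=
  [set u | forall v, X v -> f u v = 0].

(* The scalars need not commute, so the involution is an anti-automorphism;
   the vectors form a left vector space. *)
Record hilbertSpace := HilbertSpace {
  hscalar : unitRingType;
  hscalar_skewfield : GRing.field_axiom hscalar;
  hconj : hscalar -> hscalar;
  hconjD : {morph hconj : x y / x + y};
  hconjM : forall x y, hconj (x * y) = hconj y * hconj x;
  hconjK : involutive hconj;
  hvect :> lmodType hscalar;
  hform : hvect -> hvect -> hscalar;
  hformDl : forall u v w, hform (u + v) w = hform u w + hform v w;
  hformZl : forall x u v, hform (x *: u) v = x * hform u v;
  hform_herm : forall u v, hform v u = hconj (hform u v);
  hform_aniso : forall u, hform u u = 0 -> u = 0;
  hform_orthomodular : forall X : set hvect,
    GRing.submod_closed [in X] ->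
    form_orth hform (form_orth hform X) = X ->
    [set u + v | u in X & v in form_orth hform X] = setT
}.

Fact closedSubspace_display : Order.disp_t. Proof. exact: Order.Disp tt tt. Qed.

Section ClosedSubspaces.
Variable H : hilbertSpace.
Implicit Types X Y Z : set H.

Definition orth : set H -> set H := form_orth (@hform H).

Definition closed_subspace X : Prop :=
  GRing.submod_closed [in X] /\ orth (orth X) = X.

Record closedSubspace : Type := ClosedSubspace {
  cs_set : set H;
  _ : `[< closed_subspace cs_set >]
}.

HB.instance Definition _ := [isSub for cs_set].
HB.instance Definition _ := [Choice of closedSubspace by <:].

Lemma cs_setP (X : closedSubspace) : closed_subspace (cs_set X).
Proof. by apply/asboolP; case: X. Qed.

Lemma hconj0 : hconj 0 = 0 :> hscalar H.
Proof. by apply: (addIr (hconj 0)); rewrite -hconjD !add0r. Qed.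

Lemma hform_sym0 (u v : H) : hform u v = 0 -> hform v u = 0.
Proof. by move=> uv; rewrite hform_herm uv hconj0. Qed.

Lemma hform0l (v : H) : hform 0 v = 0.
Proof. by rewrite -(scale0r (0 : H)) hformZl mul0r. Qed.

Lemma orth_submod X : GRing.submod_closed [in orth X].
Proof.
split=> [|x u v]; rewrite !inE; first by move=> w _; exact: hform0l.
by move=> uX vX w Xw; rewrite hformDl hformZl uX// vX// mulr0 addr0.
Qed.

Lemma orthS X Y : X `<=` Y -> orth Y `<=` orth X.
Proof. by move=> XY u uY v /XY; exact: uY. Qed.

Lemma sub_orth_orth X : X `<=` orth (orth X).
Proof. by move=> u Xu v vX; apply/hform_sym0/vX. Qed.

Lemma orth3 X : orth (orth (orth X)) = orth X.
Proof.
by apply/seteqP; split; [apply: orthS|]; exact: sub_orth_orth.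
Qed.

Lemma orth_closed X : closed_subspace (orth X).
Proof. by split; [exact: orth_submod | exact: orth3]. Qed.

Lemma setI_closed X Y :
  closed_subspace X -> closed_subspace Y -> closed_subspace (X `&` Y).
Proof.
move=> [[X0 Xl] XK] [[Y0 Yl] YK]; split.
  split=> [|x u v]; first by move: X0 Y0; rewrite !inE.
  rewrite !inE => -[uX uY] [vX vY]; split; apply/set_mem.
    by apply: Xl; exact/mem_set.
  by apply: Yl; exact/mem_set.
apply/seteqP; split; last exact: sub_orth_orth.
by move=> u uXY; split; [rewrite -XK | rewrite -YK];
  apply: orthS uXY; apply: orthS => w [].
Qed.

Lemma setT_closed : closed_subspace setT.
Proof.
split; first by split=> [|x u v _ _]; exact: mem_setT.
by apply/seteqP; split=> //; exact: sub_orth_orth.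
Qed.

Lemma set0_closed : closed_subspace [set 0].
Proof.
suff -> : [set 0] = orth setT by exact: orth_closed.
apply/seteqP; split=> [u -> v _|u uT /=]; first exact: hform0l.
exact/hform_aniso/uT.
Qed.

Definition cs_mk X (cX : closed_subspace X) : closedSubspace :=
  ClosedSubspace (asboolT cX).

Definition cs_le (X Y : closedSubspace) : bool := `[< cs_set X `<=` cs_set Y >].

Definition cs_meet (X Y : closedSubspace) : closedSubspace :=
  cs_mk (setI_closed (cs_setP X) (cs_setP Y)).

Definition cs_join (X Y : closedSubspace) : closedSubspace :=
  cs_mk (orth_closed (orth [set u + v | u in cs_set X & v in cs_set Y])).

Definition cs_orth (X : closedSubspace) : closedSubspace :=
  cs_mk (orth_closed (cs_set X)).

Lemma cs_le_refl : reflexive cs_le.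
Proof. by move=> X; exact/asboolP. Qed.

Lemma cs_le_anti : antisymmetric cs_le.
Proof.
by move=> X Y /andP[/asboolP XY /asboolP YX]; apply/val_inj/seteqP; split.
Qed.

Lemma cs_le_trans : transitive cs_le.
Proof.
move=> Y X Z /asboolP XY /asboolP YZ; apply/asboolP.
exact: subset_trans XY YZ.
Qed.

HB.instance Definition _ :=
  Order.Le_isPOrder.Build closedSubspace_display closedSubspace
    cs_le_refl cs_le_anti cs_le_trans.

Lemma cs_leP (X Y : closedSubspace) :
  reflect (cs_set X `<=` cs_set Y) (X <= Y)%O.
Proof. exact: asboolP. Qed.

Lemma cs_meetP (X Y Z : closedSubspace) :
  (X <= cs_meet Y Z)%O = (X <= Y)%O && (X <= Z)%O.
Proof.
apply/cs_leP/andP => [XYZ|[/cs_leP XY /cs_leP XZ]].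
  by split; apply/cs_leP => u /XYZ [].
by move=> u Xu; split; [exact: XY | exact: XZ].
Qed.

Lemma cs_joinP (X Y Z : closedSubspace) :
  (cs_join X Y <= Z)%O = (X <= Z)%O && (Y <= Z)%O.
Proof.
have [[X0 _] _] := cs_setP X; have [[Y0 _] _] := cs_setP Y.
have [[_ Zl] ZK] := cs_setP Z.
apply/cs_leP/andP => [XYZ|[/cs_leP XZ /cs_leP YZ]].
  split; apply/cs_leP => u uX; apply/XYZ/sub_orth_orth.
    by exists u => //; exists 0; rewrite ?addr0//; exact: set_mem.
  by exists 0; [exact: set_mem | exists u; rewrite ?add0r].
rewrite -ZK; apply: orthS; apply: orthS => _ [u /XZ uZ [v /YZ vZ <-]].
by apply/set_mem; rewrite -[u]scale1r; apply: Zl; exact: mem_set.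
Qed.

HB.instance Definition _ :=
  Order.POrder_MeetJoin_isLattice.Build closedSubspace_display closedSubspace
    cs_meetP cs_joinP.

Lemma cs_set_meet (X Y : closedSubspace) :
  cs_set (X `&` Y)%O = cs_set X `&` cs_set Y.
Proof. by []. Qed.

Lemma cs_set_join (X Y : closedSubspace) :
  cs_set (X `|` Y)%O = orth (orth [set u + v | u in cs_set X & v in cs_set Y]).
Proof. by []. Qed.

Lemma cs_le0 (X : closedSubspace) : (cs_mk set0_closed <= X)%O.
Proof.
have [[X0 _] _] := cs_setP X.
by apply/cs_leP => _ ->; exact: set_mem.
Qed.

Lemma cs_le1 (X : closedSubspace) : (X <= cs_mk setT_closed)%O.
Proof. exact/cs_leP. Qed.

HB.instance Definition _ :=
  Order.hasBottom.Build closedSubspace_display closedSubspace cs_le0.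
HB.instance Definition _ :=
  Order.hasTop.Build closedSubspace_display closedSubspace cs_le1.

Lemma cs_orthK : involutive cs_orth.
Proof. by move=> X; apply: val_inj => /=; have [] := cs_setP X. Qed.

Lemma cs_orthS (X Y : closedSubspace) :
  (X <= Y)%O -> (cs_orth Y <= cs_orth X)%O.
Proof. by move=> /cs_leP XY; apply/cs_leP; exact: orthS. Qed.

Lemma cs_meet_orth (X : closedSubspace) : (X `&` cs_orth X = \bot)%O.
Proof.
apply: le_anti; rewrite le0x andbT; apply/cs_leP => u [uX uoX].
exact/hform_aniso/uoX.
Qed.

Lemma cs_join_orth (X : closedSubspace) : (X `|` cs_orth X = \top)%O.
Proof.
apply: le_anti; rewrite lex1 /=; apply/cs_leP; rewrite cs_set_join => u _ v vX.
suff -> : v = 0 by apply/hform_sym0/hform0l.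
apply/hform_aniso/vX; exists 0; first exact/set_mem/(cs_setP X).1.1.
exists v; rewrite ?add0r// => w wX; apply: vX.
exists w => //; exists 0; rewrite ?addr0// => z _; exact: hform0l.
Qed.

HB.instance Definition _ :=
  TBLattice_isOrtholattice.Build closedSubspace_display closedSubspace
    cs_orthK cs_orthS cs_meet_orth cs_join_orth.

Lemma cs_set_ocompl (X : closedSubspace) : cs_set (X^!)%O = orth (cs_set X).
Proof. by []. Qed.

End ClosedSubspaces.

(* Main.v *)
From HB Require Import structures.
Require Import Defs.
From mathcomp Require Import all_boot all_order all_algebra.
From mathcomp Require Import boolp classical_sets.

(* (i) In an orthomodular lattice the Sasaki projections of [w] to [a] and to
   [a^!] are [(oimp1 a w^!)^!] and [(oimp1 a^! w^!)^!]; they are orthogonal and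
   their join is above [w].  For pairs of this shape the terms $s_{ij}$ are the
   orthocomplements of [oequiv w^! a_i a_j], so that E_2 is the complemented
   4OA law; arbitrary pairs $(a_i, b_i)$ lie above the projections of
   $w = \bigcap_i (a_i \cup b_i)$ to $a_i$.

   (ii) Putting $a_n = 0$ and $b_n = 1$ turns E_n into E_{n-1}.  In a Hilbert
   space the join of orthogonal closed subspaces is their sum, so a vector of
   the left-hand side is $x_i + y_i$ with $x_i \in a_i$, $y_i \in b_i$ for every
   $i$, and $x_i - x_j = y_j - y_i$ lies in $s_{ij}$, hence in every refinement
   of $s_{ij}$.  A 4OA in which E_3, and with it every E_n, fails is given by a
   Greechie diagram with 22 atoms and 13 blocks. *)

Set Implicit Arguments.
Unset Strict Implicit.
Unset Printing Implicit Defensive.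

Import Order.TTheory GRing.Theory.

Local Open Scope order_scope.

(** * Orthomodular lattices *)

Definition oaE2_six d (L : ortholatticeType d) : Prop :=
  forall a0 b0 a1 b1 a2 b2 : L,
    operp a0 b0 -> operp a1 b1 -> operp a2 b2 ->
    (a0 `|` b0) `&` (a1 `|` b1) `&` (a2 `|` b2)
      <= b0 `|` (a0 `&` (a1 `|`
           (((a0 `|` a1) `&` (b0 `|` b1))
            `&` (((a0 `|` a2) `&` (b0 `|` b2))
                 `|` ((a1 `|` a2) `&` (b1 `|` b2)))))).

Section OrtholatticeTheory.
Context {d : Order.disp_t} {L : ortholatticeType d}.
Implicit Types a b c e p w : L.

Lemma le_ocompl a b : (b^! <= a^!) = (a <= b).
Proof.
apply/idP/idP; last exact: ocompl_antitone.
by move=> /ocompl_antitone; rewrite !ocomplK.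
Qed.

Lemma le_ocompll a b : (a^! <= b) = (b^! <= a).
Proof. by rewrite -le_ocompl ocomplK. Qed.

Lemma le_ocomplr a b : (a <= b^!) = (b <= a^!).
Proof. by rewrite -le_ocompl ocomplK. Qed.

Lemma ocompl_join a b : (a `|` b)^! = a^! `&` b^!.
Proof.
apply: le_anti; rewrite lexI !le_ocompl leUl leUr /=.
by rewrite le_ocomplr leUx !(le_ocomplr _ (_ `&` _)) leIl leIr.
Qed.

Lemma ocompl_meet a b : (a `&` b)^! = a^! `|` b^!.
Proof. by apply: (can_inj ocomplK); rewrite ocompl_join !ocomplK. Qed.

End OrtholatticeTheory.

Section OrthomodularTheory.
Context {d : Order.disp_t} {L : ortholatticeType d}.
Hypothesis oml : orthomodular L.
Implicit Types a b c e p q w : L.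

Lemma orthomodular_meet a b : b <= a -> b = a `&` (a^! `|` b).
Proof.
move=> ba; apply: (can_inj ocomplK).
by rewrite ocompl_meet ocompl_join -oml// le_ocompl.
Qed.

Lemma oimp1C_le a e : (oimp1 a e)^! <= a.
Proof. by rewrite le_ocompll leUl. Qed.

Lemma oimp1C a e : (oimp1 a e)^! = a `&` (a^! `|` e^!).
Proof. by rewrite ocompl_join ocompl_meet ocomplK. Qed.

(* [p^!] cuts [a^! `|` p] down to [a^!] and [q^!] cuts [a `|` q] down to [a],
   so the left-hand side meets [(p `|` q)^!] in [\bot]. *)
Lemma meet_orth_join a p q :
  p <= a -> q <= a^! -> (a^! `|` p) `&` (a `|` q) <= p `|` q.
Proof.
move=> pa qa; set z := _ `&` _.
have pqz : p `|` q <= z.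
  by rewrite leUx !lexI !leUr (le_trans pa (leUl _ _)) (le_trans qa (leUl _ _)).
suff z0 : (p `|` q)^! `&` z = \bot by rewrite (oml pqz) z0 joinx0.
have qaq : q^! `&` (a `|` q) = a.
  by rewrite [RHS](@orthomodular_meet q^!) ?ocomplK 1?joinC// le_ocomplr.
have pap : p^! `&` (a^! `|` p) = a^!.
  by rewrite [RHS](@orthomodular_meet p^!) ?ocomplK 1?joinC// le_ocompl.
by rewrite ocompl_join meetACA pap qaq meetC meet_ocompl.
Qed.

(** [meet_orth_join] with $p=a\cap e$ and $q=a'\cap e$, both below $e$. *)
Lemma meet_oimp1_le a e : oimp1 a e `&` oimp1 a^! e <= e.
Proof.
rewrite /oimp1 ocomplK (le_trans (meet_orth_join (leIl _ _) (leIl _ _)))//.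
by rewrite leUx !leIr.
Qed.

Lemma le_join_oimp1C a w : w <= (oimp1 a w^!)^! `|` (oimp1 a^! w^!)^!.
Proof. by rewrite -ocompl_meet le_ocomplr meet_oimp1_le. Qed.

(** * The 4OA law and its 6-variable form *)

Lemma ocompl_oequiv a b e :
  (oequiv e a b)^! =
  ((oimp1 a e)^! `|` (oimp1 b e)^!) `&` ((oimp1 a^! e)^! `|` (oimp1 b^! e)^!).
Proof. by rewrite ocompl_join !ocompl_meet. Qed.

Lemma ocompl_oequiv2 a b c e :
  (oequiv2 c e a b)^! =
  (((oimp1 a e)^! `|` (oimp1 b e)^!) `&` ((oimp1 a^! e)^! `|` (oimp1 b^! e)^!))
  `&` ((((oimp1 a e)^! `|` (oimp1 c e)^!)
          `&` ((oimp1 a^! e)^! `|` (oimp1 c^! e)^!))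
   `|` (((oimp1 b e)^! `|` (oimp1 c e)^!)
          `&` ((oimp1 b^! e)^! `|` (oimp1 c^! e)^!))).
Proof. by rewrite ocompl_join ocompl_meet !ocompl_oequiv. Qed.

Lemma oequiv2C a b c e : oequiv2 c e a b = oequiv2 c e b a.
Proof.
have oeC x y : oequiv e x y = oequiv e y x.
  by rewrite /oequiv meetC [oimp1 x^! e `&` _]meetC.
by rewrite /oequiv2 oeC meetC.
Qed.

Lemma oimp1C_perp a e : operp (oimp1 a e)^! (oimp1 a^! e)^!.
Proof.
rewrite /operp ocomplK (le_trans (oimp1C_le _ _))//.
by rewrite /oimp1 ocomplK leUl.
Qed.

Lemma oaE2_six_fourOA : oaE2_six L -> fourOA L.
Proof.
move=> E2 a b c e; rewrite oequiv2C.
set Q := oequiv2 _ _ _ _.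
(* The pair built from [b] comes first, because the law bounds $b\to_1 e$ from below. *)
have := E2 _ _ _ _ _ _ (oimp1C_perp b e) (oimp1C_perp a e) (oimp1C_perp c e).
rewrite -(ocompl_oequiv2 b a c e) -/Q -le_ocompl.
rewrite !(ocompl_join, ocompl_meet, ocomplK) => H.
have {}H : oimp1 b^! e `&` (oimp1 b e `|` (oimp1 a e `&` Q)) <= e.
  by apply: le_trans H _; rewrite !leUx !meet_oimp1_le.
set y := _ `|` _ in H.
apply: (@le_trans _ _ y); first exact: leUr.
(* Since $b'\le y$, orthomodularity gives $y=b'\cup(b\cap y)$, and [H] puts $b\cap y$ below $e$. *)
have yb : b^! <= y by rewrite (le_trans _ (leUl _ _))// leUl.
rewrite (oml yb) ocomplK leUx leUl/= (le_trans _ (leUr _ _))//.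
rewrite lexI leIl/=; apply: le_trans H; rewrite lexI leIr andbT.
by rewrite (le_trans (leIl _ _))// /oimp1 ocomplK leUl.
Qed.

(** The projection of $w$ to $a'$ lies below $a'\cap(a\cup b)$, which is $b$ by orthomodularity. *)
Lemma oimp1C_le_perp a b w :
  operp a b -> w <= a `|` b -> (oimp1 a^! w^!)^! <= b.
Proof.
move=> ab wab; rewrite oimp1C !ocomplK.
have -> : b = a^! `&` (a `|` b).
  by rewrite {1}(@orthomodular_meet a^! b) ?ocomplK// le_ocomplr.
by rewrite leI2// leUx leUl.
Qed.

Lemma fourOA_oaE2_six : fourOA L -> oaE2_six L.
Proof.
move=> H a0 b0 a1 b1 a2 b2 p0 p1 p2; set w := _ `&` (a2 `|` b2).
have w0 : w <= a0 `|` b0 by rewrite /w (le_trans (leIl _ _))// leIl.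
have w1 : w <= a1 `|` b1 by rewrite (le_trans (leIl _ _))// leIr.
have w2 : w <= a2 `|` b2 by rewrite leIr.
have sle ai bi aj bj : operp ai bi -> operp aj bj -> w <= ai `|` bi ->
    w <= aj `|` bj ->
    (oequiv w^! ai aj)^! <= (ai `|` aj) `&` (bi `|` bj).
  move=> pi pj wi wj; rewrite ocompl_oequiv leI2 ?leU2 ?oimp1C_le//;
  exact: oimp1C_le_perp.
have := H a1 a0 a2 w^!; rewrite -le_ocompl ocompl_meet oequiv2C => {}H.
(* Of the two projections of $w$, the one to $a_0'$ is below $b_0$; the complemented law [H] bounds
   the one to $a_0$. *)
apply: le_trans (le_join_oimp1C a0 w) _.
rewrite joinC leU2 ?oimp1C_le_perp// lexI oimp1C_le/= (le_trans H)//.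
rewrite leU2 ?oimp1C_le// /oequiv2 ocompl_join ocompl_meet.
by rewrite leI2 ?leU2 ?sle.
Qed.

End OrthomodularTheory.

(** * The terms R_n *)

(** Under this condition the guard in [oa_subst n] succeeds at every leaf. *)
Fixpoint oa_below (n : nat) (t : oaTerm) : bool :=
  match t with
  | OAs i j => (i < n)%N && (j < n)%N
  | OAmeet t1 t2 | OAjoin t1 t2 => oa_below n t1 && oa_below n t2
  end.

Lemma oaRS n : oaR n.+2 = oa_subst n.+2 (oaR n.+1).
Proof. by []. Qed.

Lemma oa_below_subst n t : oa_below n t -> oa_below n.+1 (oa_subst n t).
Proof.
elim: t => [i j /= /andP[ni nj]|t1 IH1 t2 IH2|t1 IH1 t2 IH2] /=.
- by rewrite ni nj /= !ltnS leqnn (ltnW ni) (ltnW nj).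
- by move=> /andP[/IH1 -> /IH2 ->].
- by move=> /andP[/IH1 -> /IH2 ->].
Qed.

Lemma oa_below_oaR n : oa_below n.+2 (oaR n.+1).
Proof. by elim: n => [//|n IH]; rewrite oaRS oa_below_subst. Qed.

(** * Descent from $E_{n+1}$ to $E_n$ *)

Section ReduceIndex.
Context {d : Order.disp_t} {L : ortholatticeType d}.

(* With [(a n, b n) = (\bot, \top)] the term [s_in] collapses to [a i], so the
   substitution defining [R_n] has no effect. *)
Lemma oa_eval_subst (n : nat) (a b a' b' : nat -> L) t :
  (forall i, (i < n)%N -> a' i = a i /\ b' i = b i) ->
  a' n = \bot -> b' n = \top -> oa_below n t ->
  oa_eval a' b' (oa_subst n t) = oa_eval a b t.
Proof.
move=> eq_ab a'n b'n.
elim: t => [i j /= /andP[ni nj]|t1 IH1 t2 IH2|t1 IH1 t2 IH2] /=.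
- rewrite ni nj /= a'n b'n !joinx0 !joinx1 !meetx1.
  have [[-> ->] [-> ->]] := (eq_ab _ ni, eq_ab _ nj).
  by apply/meet_idPl; exact: leIl.
- by move=> /andP[/IH1 -> /IH2 ->].
- by move=> /andP[/IH1 -> /IH2 ->].
Qed.

Lemma oaE_pred n : (0 < n)%N -> oaE n.+1 L -> oaE n L.
Proof.
case: n => // n _ En a b ab.
(* Of the default values only those at index [n.+2] matter: their factor $\bot\cup\top$ drops out of
   the meet. *)
pose a' i := if (i < n.+2)%N then a i else \bot.
pose b' i := if (i < n.+2)%N then b i else \top.
have /En : forall i, (i <= n.+2)%N -> operp (a' i) (b' i).
  move=> i _; rewrite /operp /a' /b'; case: ifP => [/ab//|_]; exact: le0x.
rewrite big_ord_recr /= {2}/a' {2}/b' ltnn join0x meetx1.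
rewrite (@oa_eval_subst _ a b) ?oa_below_oaR//.
- by under eq_bigr => i _ do rewrite /a' /b' ltn_ord.
- by move=> i ni; rewrite /a' /b' ni.
- by rewrite /a' ltnn.
- by rewrite /b' ltnn.
Qed.

Lemma oaE_le m n : (0 < m <= n)%N -> oaE n L -> oaE m L.
Proof.
move=> /andP[m0 /subnK <-]; elim: (n - m)%N => [//|k IH].
by rewrite addSn => /oaE_pred E; apply/IH/E; rewrite addn_gt0 m0 orbT.
Qed.

Lemma oaE2P : oaE 2 L <-> oaE2_six L.
Proof.
split=> [E2 a0 b0 a1 b1 a2 b2 ab0 ab1 ab2|E2 a b ab].
  have := E2 (nth \bot [:: a0; a1; a2]) (nth \bot [:: b0; b1; b2]).
  rewrite !big_ord_recl big_ord0 /= meetx1 meetA; apply.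
  by do 3!case=> //.
rewrite !big_ord_recl big_ord0 /= meetx1 meetA.
exact: E2 (ab _ _) (ab _ _) (ab _ _).
Qed.

End ReduceIndex.

(** * Hilbert lattices *)

Section HilbertLattice.
Local Open Scope ring_scope.
Variable H : hilbertSpace.
Implicit Types (X Y : closedSubspace H) (u v : H).

Lemma cs_memD X u v : cs_set X u -> cs_set X v -> cs_set X (u + v).
Proof.
have [[_ Xl] _] := cs_setP X => /mem_set uX /mem_set vX.
by apply/set_mem; rewrite -[u]scale1r; exact: Xl.
Qed.

Lemma cs_memN X u : cs_set X u -> cs_set X (- u).
Proof.
have [[X0 Xl] _] := cs_setP X => /mem_set uX.
by apply/set_mem; rewrite -scaleN1r -[_ *: u]addr0; exact: Xl.
Qed.

Lemma cs_memB X u v : cs_set X u -> cs_set X v -> cs_set X (u - v).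
Proof. by move=> uX /cs_memN; exact: cs_memD. Qed.

Lemma cs_mem_joinD X Y u v :
  cs_set X u -> cs_set Y v -> cs_set (X `|` Y)%O (u + v).
Proof. by move=> uX vY; apply/sub_orth_orth; exists u => //; exists v. Qed.

(* Only for orthogonal [X] and [Y] is the sum itself closed. *)
Lemma cs_join_perp X Y w : operp X Y -> cs_set (X `|` Y)%O w ->
  exists u v, [/\ cs_set X u, cs_set Y v & w = u + v].
Proof.
move=> /cs_leP XY wXY.
have split_along (Z : closedSubspace H) x :
    exists p q, [/\ cs_set Z p, cs_set (Z^!)%O q & x = p + q].
  have [Zm ZK] := cs_setP Z.
  have : setT x by [].
  by rewrite -(hform_orthomodular Zm ZK) => -[p Zp [q Zq <-]]; exists p, q.
have [p [q [Xp Xq w_pq]]] := split_along X w.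
have [r [s [Yr Ys q_rs]]] := split_along Y q.
exists p, r; split=> //; rewrite w_pq q_rs addrA.
(* The remainder [s] is orthogonal to both [X] and [Y], yet lies in their join, so it is orthogonal
   to itself. *)
suff -> : s = 0 by rewrite addr0.
have Xr : cs_set (X^!)%O r.
  by move=> x /XY xY; apply: hform_sym0; exact: xY.
have Xs : cs_set (X^!)%O s.
  have -> : s = q - r by rewrite q_rs addrC addKr.
  exact: (@cs_memB (X^!)%O).
have s_eq : s = w - (p + r).
  by apply/eqP; rewrite eq_sym subr_eq w_pq q_rs addrA [_ + s]addrC.
apply: hform_aniso.
have : cs_set (X `|` Y)%O s.
  by rewrite s_eq; apply: (@cs_memB (X `|` Y)%O) => //; exact: cs_mem_joinD.
apply=> _ [x Xx [y Yy <-]].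
apply: hform_sym0; rewrite hformDl !(@hform_sym0 _ s) ?addr0//.
  exact: Ys.
exact: Xs.
Qed.

(* The shape of [t] forces its value to contain $x_i - x_j$. *)
Inductive oa_links : oaTerm -> nat -> nat -> Prop :=
  | oa_links_s i j : oa_links (OAs i j) i j
  | oa_links_meet t1 t2 i j :
      oa_links t1 i j -> oa_links t2 i j -> oa_links (OAmeet t1 t2) i j
  | oa_links_join t1 t2 i k j :
      oa_links t1 i k -> oa_links t2 k j -> oa_links (OAjoin t1 t2) i j
  | oa_links_sym t i j : oa_links t i j -> oa_links t j i.

(** The new factor links $i$ to $j$ through $n$: $x_i-x_j=(x_i-x_n)+(x_n-x_j)$. *)
Lemma oa_links_subst n t i j : oa_links t i j -> oa_links (oa_subst n t) i j.
Proof.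
elim=> {t i j} [i j|t1 t2 i j _ IH1 _ IH2|t1 t2 i k j _ IH1 _ IH2|t i j _ IH]
  /=.
- case: ifP => _; last exact: oa_links_s.
  apply: oa_links_meet; first exact: oa_links_s.
  apply: (@oa_links_join _ _ _ n); first exact: oa_links_s.
  exact/oa_links_sym/oa_links_s.
- exact: oa_links_meet.
- exact: oa_links_join IH1 IH2.
- exact: oa_links_sym.
Qed.

Lemma oa_links_oaR n : oa_links (oaR n.+1) 0 1.
Proof.
elim: n => [|n IH]; first exact: oa_links_s.
by rewrite oaRS; exact: oa_links_subst.
Qed.

Lemma oa_links_eval n (a b : nat -> closedSubspace H) (x y : nat -> H) u t i j :
  (forall k, (k < n)%N ->
     [/\ cs_set (a k) (x k), cs_set (b k) (y k) & u = x k + y k]) ->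
  oa_links t i j -> oa_below n t -> cs_set (oa_eval a b t) (x i - x j).
Proof.
move=> xyP.
elim=> {t i j} [i j|t1 t2 i j _ IH1 _ IH2|t1 t2 i k j _ IH1 _ IH2|t i j _ IH]
  /=.
- move=> /andP[/xyP[xi yi ui] /xyP[xj yj uj]]; split.
    by apply: cs_mem_joinD => //; exact: cs_memN.
  have -> : x i - x j = - y i + y j.
    by apply/eqP; rewrite subr_eq -addrA [y j + _]addrC -uj ui addrC addrK.
  by apply: cs_mem_joinD => //; exact: cs_memN.
- by move=> /andP[/IH1 ? /IH2 ?]; split.
- move=> /andP[/IH1 ik /IH2 kj].
  by rewrite -(subrK (x k) (x i)) -addrA; exact: cs_mem_joinD.
- by move=> /IH ij; rewrite -opprB; exact: cs_memN.
Qed.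

Lemma closedSubspace_oaE n : (0 < n)%N -> oaE n (closedSubspace H).
Proof.
case: n => // n _ a b ab; apply/cs_leP => u uab.
have /choice[x xP] : forall i, exists v : H, (i < n.+2)%N ->
    cs_set (a i) v /\ cs_set (b i) (u - v).
  move=> i.
  (* Beyond the range any vector will do; [choice] asks for one at every index. *)
  case: (ltnP i n.+2) => [ni|_]; last by exists 0.
  have [||v [w [av bw ->]]] := @cs_join_perp (a i) (b i) u; first exact: ab.
    apply: (elimT (cs_leP _ _)) uab.
    exact: (@meets_inf _ _ _ (Ordinal ni) _ (fun i : 'I_n.+2 => a i `|` b i)%O).
  by exists v => _; rewrite addrC addKr.
(* The decomposition $u=(u-x_0)+x_0$ with $x_0=x_1+(x_0-x_1)$ follows the shape of the right-hand
   side. *)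
have [[x0 y0] [x1 _]] := (xP 0 isT, xP 1 isT).
rewrite -(subrK (x 0) u); apply: cs_mem_joinD => //.
split=> //; rewrite -(subrK (x 1) (x 0)) addrC; apply: cs_mem_joinD => //.
apply: (@oa_links_eval n.+2 _ _ _ (fun i => u - x i) u).
- by move=> i /xP[ai bi]; split; rewrite //= addrC subrK.
- exact: oa_links_oaR.
- exact: oa_below_oaR.
Qed.

End HilbertLattice.

(** * A 4OA in which E_3 fails *)

Inductive gatom : Type :=
  | g0 | g1 | g2 | g3 | g4 | g5 | g6 | g7 | g8 | g9 | g10
  | g11 | g12 | g13 | g14 | g15 | g16 | g17 | g18 | g19 | g20 | g21.

Scheme Boolean Equality for gatom.

Definition gatoms : seq gatom :=
  [:: g0; g1; g2; g3; g4; g5; g6; g7; g8; g9; g10;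
      g11; g12; g13; g14; g15; g16; g17; g18; g19; g20; g21].

Lemma gatom_beqP : Equality.axiom gatom_beq.
Proof. by case; case; constructor. Qed.

HB.instance Definition _ := hasDecEq.Build gatom gatom_beqP.

Lemma mem_gatoms (p : gatom) : p \in gatoms.
Proof. by move: p; case. Qed.

Lemma gatom_codeK : cancel (index^~ gatoms) (nth g0 gatoms).
Proof. by move=> p; rewrite nth_index ?mem_gatoms. Qed.

HB.instance Definition _ := Choice.copy gatom (can_type gatom_codeK).

(* Two atoms are orthogonal when they share a block.  The diagram has no loop
   of order less than 5, so that two distinct atoms have at most one atom [c]
   orthogonal to both; their join is then the coatom [c^!]. *)
Definition gblocks : seq (seq gatom) :=
  [:: [:: g3; g19; g7]; [:: g10; g15; g16]; [:: g0; g1; g11]; [:: g1; g2; g12];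
      [:: g2; g3; g13]; [:: g3; g4; g14]; [:: g4; g5; g11]; [:: g5; g6; g16];
      [:: g6; g7; g17]; [:: g7; g8; g18]; [:: g8; g9; g12]; [:: g9; g10; g20];
      [:: g10; g0; g21]].

(* [(false, None)] is the bottom and [(true, None)] the top; flipping the
   boolean is the orthocomplementation. *)
Definition goml : Type := (bool * option gatom)%type.
Definition atom p : goml := (false, Some p).
Definition coatom p : goml := (true, Some p).

HB.instance Definition _ := Choice.on goml.

Definition gorth_spec (p q : gatom) : bool :=
  (p != q) && has (fun b => (p \in b) && (q \in b)) gblocks.

Definition gjoin_spec (p q : gatom) : goml :=
  if p == q then atom p
  else if [seq c <- gatoms | gorth_spec c p && gorth_spec c q] is c :: _
  then coatom c else (true, None).

(* Tabulated by case analysis on both atoms, so that a lookup is two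
   [match] reductions. *)
Ltac tabulate :=
  case; case;
  match goal with |- {r | r = ?s} =>
    let v := eval vm_compute in s in exact (exist _ v (erefl v)) end.

Definition gorth_table : forall p q, {r | r = gorth_spec p q}.
Proof. tabulate. Defined.

Definition gjoin_table : forall p q, {r | r = gjoin_spec p q}.
Proof. tabulate. Defined.

Definition gorth p q := sval (gorth_table p q).
Definition gjoin_atom p q := sval (gjoin_table p q).

Definition gcompl (x : goml) : goml := let: (s, p) := x in (~~ s, p).

Definition gle (x y : goml) : bool :=
  match x, y with
  | (false, None), _ | _, (true, None) => true
  | (false, Some p), (false, Some q) | (true, Some p), (true, Some q) =>
      gatom_beq p q
  | (false, Some p), (true, Some q) => gorth p q
  | _, _ => false
  end.

(** In the last case one argument is a coatom or the top, so incomparable arguments join to the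
    top. *)
Definition gjoin (x y : goml) : goml :=
  match x, y with
  | (false, None), z | z, (false, None) => z
  | (false, Some p), (false, Some q) => gjoin_atom p q
  | _, _ => if gle x y then y else if gle y x then x else (true, None)
  end.

Definition gmeet (x y : goml) : goml :=
  gcompl (gjoin (gcompl x) (gcompl y)).

Definition gelts : seq goml :=
  [:: (false, None), (true, None) & map atom gatoms ++ map coatom gatoms].

Lemma mem_gelts x : x \in gelts.
Proof. by case: x => [[] [[]|]]. Qed.

(** Turns a statement about the 46 elements into a boolean computation. *)
Lemma gall (P : goml -> bool) : all P gelts -> forall x, P x.
Proof. by move=> /allP gP x; apply/gP/mem_gelts. Qed.

Lemma gall2 (P : goml -> goml -> bool) :
  all (fun x => all (P x) gelts) gelts -> forall x y, P x y.
Proof. by move=> /gall gP x; exact/gall/gP. Qed.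

Lemma gall3 (P : goml -> goml -> goml -> bool) :
  all (fun x => all (fun y => all (P x y) gelts) gelts) gelts ->
  forall x y z, P x y z.
Proof. by move=> /gall gP x; exact/gall2/gP. Qed.

Lemma gle_refl : reflexive gle.
Proof. by apply: gall; vm_compute. Qed.

Lemma gle_anti : antisymmetric gle.
Proof.
suff H x y : gle x y && gle y x ==> (x == y).
  by move=> x y /(implyP (H x y)) /eqP.
by move: x y; apply: gall2; vm_compute.
Qed.

Lemma gle_trans : transitive gle.
Proof.
suff H x y z : gle x y ==> (gle y z ==> gle x z).
  by move=> y x z /(implyP (H x y z)) /implyP.
by move: x y z; apply: gall3; vm_compute.
Qed.

Fact goml_display : Order.disp_t. Proof. exact: Order.Disp tt tt. Qed.

HB.instance Definition _ :=
  Order.Le_isPOrder.Build goml_display goml gle_refl gle_anti gle_trans.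

Lemma gmeetP (x y z : goml) : (x <= gmeet y z) = (x <= y) && (x <= z).
Proof.
suff H : gle x (gmeet y z) == gle x y && gle x z by exact/eqP.
by move: x y z; apply: gall3; vm_compute.
Qed.

Lemma gjoinP (x y z : goml) : (gjoin x y <= z) = (x <= z) && (y <= z).
Proof.
suff H : gle (gjoin x y) z == gle x z && gle y z by exact/eqP.
by move: x y z; apply: gall3; vm_compute.
Qed.

HB.instance Definition _ :=
  Order.POrder_MeetJoin_isLattice.Build goml_display goml gmeetP gjoinP.

Lemma gle0 (x : goml) : ((false, None) : goml) <= x.
Proof. by []. Qed.

Lemma gle1 (x : goml) : x <= ((true, None) : goml).
Proof. by case: x => [[] []]. Qed.

HB.instance Definition _ :=
  Order.hasBottom.Build goml_display goml gle0.
HB.instance Definition _ :=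
  Order.hasTop.Build goml_display goml gle1.

Lemma gcomplK : involutive gcompl.
Proof. by case=> [[] []]. Qed.

Lemma gcompl_antitone (x y : goml) : x <= y -> gcompl y <= gcompl x.
Proof.
suff H : gle x y ==> gle (gcompl y) (gcompl x) by exact/implyP.
by move: x y; apply: gall2; vm_compute.
Qed.

Lemma gmeet_compl (x : goml) : x `&` gcompl x = \bot.
Proof. by apply/eqP; move: x; apply: gall; vm_compute. Qed.

Lemma gjoin_compl (x : goml) : x `|` gcompl x = \top.
Proof. by apply/eqP; move: x; apply: gall; vm_compute. Qed.

HB.instance Definition _ :=
  TBLattice_isOrtholattice.Build goml_display goml
    gcomplK gcompl_antitone gmeet_compl gjoin_compl.

(** * The 4OA law by exhaustive computation *)

Definition gimp (x e : goml) : goml := gjoin (gcompl x) (gmeet x e).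

(* The 4OA law involves [x] only through this pair, and $x \overset{e}{\equiv}y$
   is [gequiv] of two such pairs. *)
Definition gpair (e x : goml) := (gimp x e, gimp (gcompl x) e).

Definition gequiv (p q : goml * goml) : goml :=
  gjoin (gmeet p.1 q.1) (gmeet p.2 q.2).

(* [s] and [t] are the rows of [p] and [q] in the matrix of values of [gequiv],
   which [gfourOA_at] computes once for each [e]. *)
Definition gtest (p q : goml * goml) (s t : seq goml) : bool :=
  gle p.1 q.1 ||
  (let x := gequiv p q in
   all2 (fun y z => gle (gmeet p.1 (gjoin x (gmeet y z))) q.1) s t).

Definition gfourOA_at (e : goml) : bool :=
  let ps := map (gpair e) gelts in
  let rs := map (fun p => (p, map (gequiv p) ps)) ps in
  all (fun r => all (fun r' => gtest r.1 r'.1 r.2 r'.2) rs) rs.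

Lemma gfourOA_check : all gfourOA_at gelts.
Proof. by vm_compute. Qed.

Lemma all2_map2 (T U V : Type) (f : U -> V -> bool) (g : T -> U) (h : T -> V)
    s :
  all2 f (map g s) (map h s) = all (fun x => f (g x) (h x)) s.
Proof. by elim: s => //= x s ->. Qed.

Lemma gleE (x y : goml) : (x <= y) = gle x y. Proof. by []. Qed.
Lemma gmeetE (x y : goml) : x `&` y = gmeet x y. Proof. by []. Qed.
Lemma gjoinE (x y : goml) : x `|` y = gjoin x y. Proof. by []. Qed.
Lemma gcomplE (x : goml) : x^! = gcompl x. Proof. by []. Qed.

Lemma goimp1E (x e : goml) : oimp1 x e = gimp x e.
Proof. by rewrite /oimp1 gcomplE gmeetE gjoinE. Qed.

Lemma goequivE (e x y : goml) : oequiv e x y = gequiv (gpair e x) (gpair e y).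
Proof. by rewrite /oequiv !goimp1E !gcomplE !gmeetE gjoinE. Qed.

Lemma gtest_map p q ps :
  gtest p q (map (gequiv p) ps) (map (gequiv q) ps) =
  gle p.1 q.1 || all (fun r => gle (gmeet p.1 (gjoin (gequiv p q)
    (gmeet (gequiv p r) (gequiv q r)))) q.1) ps.
Proof. by rewrite /gtest all2_map2. Qed.

Lemma goml_fourOA : fourOA goml.
Proof.
move=> a b c e; rewrite /oequiv2 !goequivE !goimp1E !gmeetE gjoinE gleE.
have := gall gfourOA_check e; rewrite /gfourOA_at.
set r := map _ (map _ _).
have mem_r x :
    (gpair e x, map (gequiv (gpair e x)) (map (gpair e) gelts)) \in r.
  exact/map_f/map_f/mem_gelts.
move=> /allP /(_ _ (mem_r a)) /allP /(_ _ (mem_r b)).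
(* If $a\to_1 e\le b\to_1 e$ the law is immediate; otherwise the row test covers every [c]. *)
rewrite gtest_map all_map => /orP[ab|/gall /(_ c)]; last by apply.
by apply: (gle_trans _ ab); rewrite -gmeetE -gleE leIl.
Qed.

(* The blocks containing these pairs have the third atoms [g7], [g7], [g4] and
   [g2], all orthogonal to [g3]; so [atom g3] is below the left-hand side. *)
Lemma goml_not_oaE3 : ~ oaE 3 goml.
Proof.
move=> /(_ (nth \bot [:: atom g8; atom g17; atom g5; atom g1])
          (nth \bot [:: atom g18; atom g6; atom g11; atom g12])).
rewrite !big_ord_recl big_ord0 => E3.
(* The inequality in [E3] is closed and reduces to [false]; orthogonality of the four pairs
   remains. *)
suff : false by []; apply: E3 => i.
by do 4!case: i => [|i]//.
Qed.

Theorem theorem5p2 :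
  (* (i) *)
  ((forall (d : Order.disp_t) (L : ortholatticeType d),
      oaE 2 L <->
      (forall a0 b0 a1 b1 a2 b2 : L,
         operp a0 b0 -> operp a1 b1 -> operp a2 b2 ->
         (a0 `|` b0) `&` (a1 `|` b1) `&` (a2 `|` b2)
           <= b0 `|` (a0 `&` (a1 `|`
                (((a0 `|` a1) `&` (b0 `|` b1))
                 `&` (((a0 `|` a2) `&` (b0 `|` b2))
                      `|` ((a1 `|` a2) `&` (b1 `|` b2)))))))) /\
   (forall (d : Order.disp_t) (L : ortholatticeType d),
      orthomodular L -> (oaE 2 L <-> fourOA L))) /\
  (* (ii) *)
  (forall n : nat, (3 <= n)%N ->
     [/\ forall (d : Order.disp_t) (L : ortholatticeType d),
           orthomodular L -> oaE n L -> fourOA L,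
         forall H : hilbertSpace, oaE n (closedSubspace H) &
         exists (d : Order.disp_t) (L : ortholatticeType d),
           fourOA L /\ ~ oaE n L]).
Proof.
split; first split=> d L.
- exact: oaE2P.
- by move=> oml; rewrite oaE2P; split;
    [exact: oaE2_six_fourOA | exact: fourOA_oaE2_six].
move=> n n3; split=> [d L oml|H|].
- move=> /(@oaE_le _ _ 2) E2; apply/oaE2_six_fourOA/oaE2P/E2 => //.
  exact: ltnW.
- by apply: closedSubspace_oaE; exact: leq_trans n3.
- exists goml_display, goml; split; first exact: goml_fourOA.
  by move=> /(@oaE_le _ _ 3) E3; exact/goml_not_oaE3/E3.
Qed.
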